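(* Let $\mathcal{H}=(V,E)$ be a connected hypergraph, $e\in E$ an edge and $v\in e$ a vertex. If $(\{e\},\{e\setminus\{v\}\},\{\{v\}\})$ is a weak cut, then $$\mathcal{E}\big(\mathcal{H}\triangleleft(e,e\setminus\{v\},\{v\})\big)<\mathcal{E}(\mathcal{H}).$$
   Context: A hypergraph $\mathcal{H}=(V,E)$ consists of a finite vertex set $V$ and a set $E$ of edges, each a subset of $V$ of cardinality at least $2$ (distinct edges distinct). A multi-hypergraph is a pair $(V,E)$ with $E$ a multiset of subsets of $V$ (of any cardinality). For a (multi-)hypergraph and $i\neq j$, $d(\{i,j\})$ is the number of edges (with multiplicity) containing both $i$ and $j$; the adjacency matrix has zero diagonal and $(i,j)$ entry $d(\{i,j\})$, and the energy $\mathcal{E}$ is the sum of absolute values of its eigenvalues. A walk is a sequence $v_0e_1v_1\dots e_lv_l$ with $v_{i-1},v_i$ distinct vertices of the edge $e_i$; a (multi-)hypergraph is connected if every two vertices are joined by a walk. $\mathcal{H}\triangleleft(e,e\setminus\{v\},\{v\})$ is the multi-hypergraph on $V$ obtained from $E$ by replacing the edge $e$ with the two edges $e\setminus\{v\}$ and $\{v\}$. More generally, for $F=\{e_1,\dots,e_t\}\subseteq E$ with divisions $e_i=e_i'\cup e_i''$ ($e_i',e_i''$ nonempty, disjoint), $\mathcal{H}\triangleleft(F,F',F'')=(V,(E\cup F'\cup F'')\setminus F)$; for connected $\mathcal{H}$, $(F,F',F'')$ is a weak cut if $\mathcal{H}\triangleleft(F,F',F'')$ is disconnected and for no proper subset $P\subsetneq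 F$ and no choice of divisions of the edges of $P$ is the resulting multi-hypergraph disconnected. *)

(* Defs.v *)
(* MathComp, with multisets from mathcomp-finmap. *)
From HB Require Import structures.
From mathcomp Require Import all_boot all_order all_algebra.
From mathcomp Require Import finmap multiset.

Set Implicit Arguments.
Unset Strict Implicit.
Unset Printing Implicit Defensive.

Import Order.TTheory GRing.Theory Num.Theory.

Local Open Scope mset_scope.
Local Open Scope ring_scope.

(* [V : finType] is the vertex set; [{mset _}] records edge multiplicities. *)
Definition multihypergraph (V : finType) := {mset {set V}}.

Record hypergraph (V : finType) := Hypergraph {
  edges :> {set {set V}};
  edges_card : forall e : {set V}, e \in edges -> (2 <= #|e|)%N
}.

Definition multi_of (V : finType) (H : hypergraph V) : multihypergraph V :=
  seq_mset (enum (edges H)).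

(* [E e] is the multiplicity of [e] in [E]. *)
Definition codegree (V : finType) (E : multihypergraph V) (i j : V) : nat :=
  \sum_(e : {set V} | (i \in e) && (j \in e)) E e.

(* Rows and columns are indexed along the enumeration of [V]. *)
Definition adjacency (C : numClosedFieldType) (V : finType)
    (E : multihypergraph V) : 'M[C]_#|V| :=
  \matrix_(i, j)
    if i == j then 0 else (codegree E (enum_val i) (enum_val j))%:R.

(* The roots of the characteristic polynomial, with multiplicity. *)
Definition spectrum (C : numClosedFieldType) (n : nat) (A : 'M[C]_n) : seq C :=
  sval (closed_field_poly_normal (char_poly A)).

(* Valued in [C], where [<] between two such sums of norms is the usual order,
   both being nonnegative reals. *)
Definition energy (C : numClosedFieldType) (V : finType)
    (E : multihypergraph V) : C :=
  \sum_(z <- spectrum (adjacency C E)) `|z|.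

(* The walk v0 e1 v1 ... el vl is encoded by its start v0 together with the
   sequence [:: (e1, v1); ...; (el, vl)]. *)
Fixpoint is_walk (V : finType) (E : multihypergraph V) (u : V)
    (w : seq ({set V} * V)) : bool :=
  if w is (e, x) :: w' then
    [&& e \in E, u \in e, x \in e, u != x & is_walk E x w']
  else true.

Definition connected (V : finType) (E : multihypergraph V) : Prop :=
  forall u x : V, exists w : seq ({set V} * V),
    is_walk E u w /\ last u (map snd w) = x.

(* A choice of divisions of the edges of [F] is given by two functions, each
   edge [e] in [F] being divided into [f e] and [g e]. *)
Definition divisions (V : finType) (F : {set {set V}})
    (f g : {set V} -> {set V}) : Prop :=
  forall e : {set V}, e \in F ->
    [/\ f e != set0, g e != set0, [disjoint f e & g e] & e = f e :|: g e].

(* Sum and difference are those of multisets: a part which is already an edge,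
   or which arises from several edges, is counted with its multiplicity. *)
Definition edge_division (V : finType) (H : hypergraph V) (F : {set {set V}})
    (f g : {set V} -> {set V}) : multihypergraph V :=
  (multi_of H `+` seq_mset [seq f e | e <- enum F]
              `+` seq_mset [seq g e | e <- enum F]) `\` seq_mset (enum F).

Definition weak_cut (V : finType) (H : hypergraph V) (F : {set {set V}})
    (f g : {set V} -> {set V}) : Prop :=
  [/\ F \subset edges H, divisions F f g, ~ connected (edge_division H F f g)
    & ~ exists (P : {set {set V}}) (f' g' : {set V} -> {set V}),
          [/\ P \proper F, divisions P f' g'
            & ~ connected (edge_division H P f' g')]].

(* Main.v *)
(* Let A and B be the adjacency matrices before and after the division.  Only e
   joins the component S of v in the divided hypergraph to the rest T, and
   e meets S in v alone; so B is the block diagonal part of A along (S, T), and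
   A - B is supported on the row and the column of v.  The sign U of B is a
   block diagonal hermitian involution, so that the energy of B is
   tr (U B) = tr (U A), which is at most the energy of A.  In case of equality,
   U A = |A| and U commutes with A and with B, hence with A - B; this
   makes the basis vector at v an eigenvector of U.  As A v v = 0, the diagonal
   entry of |A| at v vanishes, hence so does the whole row of A at v,
   although v is joined by e to T. *)
Require Import Defs.
From HB Require Import structures.
From mathcomp Require Import all_boot all_order all_algebra.
From mathcomp Require Import sesquilinear spectral.
From mathcomp Require Import finmap multiset.
Import Order.TTheory GRing.Theory Num.Theory.
Local Open Scope ring_scope.

(** * Trace norms of hermitian matrices *)

Section TraceNorm.
Set Implicit Arguments.
Unset Strict Implicit.
Unset Printing Implicit Defensive.
Local Open Scope sesquilinear_scope.

Lemma char_poly_similar (R : comNzRingType) n (Q P A : 'M[R]_n) :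
  Q *m P = 1%:M -> char_poly (Q *m A *m P) = char_poly A.
Proof.
move=> QP; have QP' : map_mx polyC Q *m map_mx polyC P = 1%:M.
  by rewrite -map_mxM QP map_mx1.
rewrite /char_poly -[RHS]mul1r -(det1 _ n) -QP' det_mulmx mulrAC -!det_mulmx.
congr (\det _); rewrite /char_poly_mx mulmxBr mulmxBl !map_mxM /=.
by rewrite scalar_mxC -(mulmxA 'X%:M) QP' mulmx1.
Qed.

Variable C : numClosedFieldType.

Lemma hermitian_conjE n (A : 'M[C]_n) : A ^t* = A -> forall i j, (A i j)^* = A j i.
Proof. by move=> hA i j; rewrite -[in RHS]hA !mxE. Qed.

(** On hermitian matrices this is the trace norm; at an adjacency matrix it is the energy by
    conversion. *)
Definition trace_norm n (A : 'M[C]_n) : C := \sum_(z <- spectrum A) `|z|.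

Lemma trace_norm_unitary n (P : 'M[C]_n) (d : 'rV[C]_n) : P \is unitarymx ->
  trace_norm (P ^t* *m diag_mx d *m P) = \sum_k `|d 0 k|.
Proof.
move=> uP; rewrite /trace_norm /spectrum.
case: closed_field_poly_normal => r /=.
rewrite (monicP (char_poly_monic _)) scale1r => Er.
have E : \prod_(z <- r) ('X - z%:P)
       = \prod_(z <- [seq d 0 k | k <- enum 'I_n]) ('X - z%:P).
  rewrite -Er char_poly_similar; last first.
    by rewrite -invmx_unitary // mulVmx ?unitarymx_unit.
  rewrite char_poly_trig ?diag_mx_is_trig // big_map enumT.
  by apply: eq_bigr => k _; rewrite mxE eqxx mulr1n.
have {}E : perm_eq r [seq d 0 k | k <- enum 'I_n] by exact: prod_XsubC_eq E.
by rewrite (perm_big _ E) big_map enumT.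
Qed.

Lemma hermitian_diag n (A : 'M[C]_n) : A ^t* = A ->
  exists (P : 'M[C]_n) (d : 'rV[C]_n), [/\ P \is unitarymx,
    forall k, d 0 k \is Num.real & A = P ^t* *m diag_mx d *m P].
Proof.
move=> hA; have hA' : A \is hermsymmx.
  by apply/is_hermitianmxP; rewrite expr0 scale1r hA.
exists (spectralmx A), (spectral_diag A); split.
- exact: spectral_unitarymx.
- by move=> k; move/mxOverP: (hermitian_spectral_diag_real hA').
- rewrite -invmx_unitary ?spectral_unitarymx //.
  exact/orthomx_spectralP/hermitian_normalmx.
Qed.

Lemma unitary_mul_tr n (P : 'M[C]_n) : P \is unitarymx -> P *m P ^t* = 1%:M.
Proof. by move/unitarymxP. Qed.

Lemma unitary_tr_mul n (P : 'M[C]_n) : P \is unitarymx -> P ^t* *m P = 1%:M.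
Proof. by move=> uP; rewrite -invmx_unitary // mulVmx ?unitarymx_unit. Qed.

Lemma trmxC_mul m n p (A : 'M[C]_(m, n)) (B : 'M[C]_(n, p)) :
  (A *m B) ^t* = B ^t* *m A ^t*.
Proof. by rewrite trmx_mul map_mxM. Qed.

Lemma trmxC_real_diag n (d : 'rV[C]_n) : (forall k, d 0 k \is Num.real) ->
  (diag_mx d) ^t* = diag_mx d.
Proof.
move=> dR; rewrite tr_diag_mx map_diag_mx; congr diag_mx.
by apply/rowP=> k; rewrite mxE; apply/CrealP/dR.
Qed.

Lemma mxtrace_unitary n (P N : 'M[C]_n) : P \is unitarymx ->
  \tr (P ^t* *m N *m P) = \tr N.
Proof. by move=> uP; rewrite mxtrace_mulC mulmxA unitary_mul_tr // mul1mx. Qed.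

Lemma unitary_conjM n (P M N : 'M[C]_n) : P \is unitarymx ->
  (P ^t* *m M *m P) *m (P ^t* *m N *m P) = P ^t* *m (M *m N) *m P.
Proof. by move=> uP; rewrite !mulmxA -(mulmxA _ P) unitary_mul_tr // mulmx1. Qed.

Lemma unitary_conjK n (P M : 'M[C]_n) : P \is unitarymx ->
  P *m (P ^t* *m M *m P) *m P ^t* = M.
Proof.
move=> uP; rewrite !mulmxA unitary_mul_tr // mul1mx -mulmxA unitary_mul_tr //.
by rewrite mulmx1.
Qed.

Lemma unitary_conjVK n (P M : 'M[C]_n) : P \is unitarymx ->
  P ^t* *m (P *m M *m P ^t*) *m P = M.
Proof.
move=> uP; rewrite !mulmxA unitary_tr_mul // mul1mx -mulmxA unitary_tr_mul //.
by rewrite mulmx1.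
Qed.

Lemma hermitian_sign n (B : 'M[C]_n) : B ^t* = B ->
  exists U : 'M[C]_n, [/\ U ^t* = U, U *m U = 1%:M,
    forall M, comm_mx M B -> comm_mx M U & \tr (U *m B) = trace_norm B].
Proof.
case/hermitian_diag=> P [d [uP dR EB]].
(* Taking sign 1 at 0 makes U an involution even if B is singular. *)
pose s : 'rV[C]_n := \row_k (if 0 <= d 0 k then 1 else -1).
have sR k : s 0 k \is Num.real by rewrite mxE; case: ifP; rewrite ?rpredN rpred1.
have sds k : s 0 k * d 0 k = `|d 0 k|.
  rewrite mxE; case: ifP => [/ger0_norm->|]; first exact: mul1r.
  by have := dR k; rewrite realE => /orP[->//|d0] _; rewrite mulN1r ler0_norm.
exists (P ^t* *m diag_mx s *m P); split.
- by rewrite !trmxC_mul trmxCK trmxC_real_diag // mulmxA.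
- rewrite unitary_conjM // mulmx_diag (_ : \row__ _ = const_mx 1).
    by rewrite diag_const_mx mulmx1 unitary_tr_mul.
  by apply/rowP=> k; rewrite !mxE; case: ifP; rewrite ?mulrNN mulr1.
- move=> M; rewrite /comm_mx EB -(unitary_conjVK M uP).
  move: (P *m M *m P ^t*) => {}M; rewrite !unitary_conjM // => cMB.
  have {}cMB : M *m diag_mx d = diag_mx d *m M.
    by rewrite -(unitary_conjK (M *m _) uP) cMB unitary_conjK.
  (* Entry [(i, j)] of [cMB] gives [M i j = 0] or [d 0 i = d 0 j]; in the latter case the signs
     agree too. *)
  congr (_ *m _ *m _); apply/matrixP=> i j; have /matrixP/(_ i j) := cMB.
  rewrite mul_mx_diag mul_diag_mx mul_mx_diag mul_diag_mx !mxE mulrC => /eqP.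
  rewrite -subr_eq0 -mulrBl mulf_eq0 subr_eq0 => /orP[/eqP->|/eqP->].
    exact: mulrC.
  by rewrite mul0r mulr0.
- rewrite EB trace_norm_unitary // unitary_conjM // mulmx_diag mxtrace_unitary //.
  by rewrite mxtrace_diag; apply: eq_bigr => k _; rewrite -sds !mxE.
Qed.

(** In an eigenbasis of [A], [U] becomes a matrix [N] with rows of norm 1, so the trace is a sum of
    terms [N k k * d 0 k], each at most [|d 0 k|]. Equality of the sums forces equality in every
    term, and then [U A] is the positive semidefinite matrix [|A|]. *)
Lemma trace_mul_involution_lt n (A U : 'M[C]_n) :
  A ^t* = A -> U ^t* = U -> U *m U = 1%:M ->
  \tr (U *m A) < trace_norm A \/
  comm_mx U A /\ forall v, (U *m A) v v = 0 -> forall j, A v j = 0.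
Proof.
move=> hA hU UU; have [P [d [uP dR EA]]] := hermitian_diag hA.
pose a : 'rV[C]_n := \row_k `|d 0 k|.
have [N EU] : exists N, U = P ^t* *m N *m P.
  by exists (P *m U *m P ^t*); rewrite unitary_conjVK.
have hN : N ^t* = N.
  by rewrite -(unitary_conjK N uP) -EU !trmxC_mul trmxCK hU mulmxA.
have NN : N *m N = 1%:M.
  rewrite -(unitary_conjK (N *m N) uP) -unitary_conjM // -EU UU mulmx1.
  exact: unitary_mul_tr.
have row1 k : \sum_j `|N k j| ^+ 2 = 1.
  have <- : (N *m N) k k = 1 by rewrite NN mxE eqxx.
  by rewrite mxE; apply: eq_bigr => j _; rewrite normCK hermitian_conjE.
have NkkR k : N k k \is Num.real by apply/CrealP; rewrite hermitian_conjE.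
have Nkk1 k : `|N k k| <= 1.
  rewrite -(@expr_le1 _ 2) // -(row1 k) (bigD1 k) //= lerDl.
  by apply: sumr_ge0 => j _; rewrite exprn_ge0.
have EUA : U *m A = P ^t* *m (N *m diag_mx d) *m P by rewrite EU EA unitary_conjM.
have EAU : A *m U = P ^t* *m (diag_mx d *m N) *m P by rewrite EU EA unitary_conjM.
have leN k : N k k * d 0 k <= `|d 0 k|.
  apply: le_trans (real_ler_norm _) _; first by rewrite realM.
  by rewrite normrM ler_piMl.
have leT : \tr (U *m A) <= trace_norm A ?= iff [forall k, N k k * d 0 k == `|d 0 k|].
  rewrite EUA mxtrace_unitary // EA trace_norm_unitary // /mxtrace.
  have -> : \sum_i (N *m diag_mx d) i i = \sum_i N i i * d 0 i.
    by apply: eq_bigr => i _; rewrite mul_mx_diag mxE.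
  by apply: leif_sum => k _; split.
have [/forallP Neq|ne] := boolP [forall k, N k k * d 0 k == `|d 0 k|]; last first.
  by left; rewrite (ltNge, lt_leif leT).
right.
(* If [d 0 k] is nonzero, [|N k k| = 1] exhausts the norm of row [k], so its other entries vanish;
   if it is zero, [diag_mx d] kills the row. *)
have dN : diag_mx d *m N = diag_mx a.
  apply/matrixP=> k j; rewrite mul_diag_mx !mxE.
  have [<-|kj] := eqVneq k j; first by rewrite mulrC (eqP (Neq k)).
  rewrite mulr0n; have [->|d0] := eqVneq (d 0 k) 0; first by rewrite mul0r.
  have /eqP/(congr1 Num.norm) := Neq k.
  rewrite normrM normr_id => /(canRL (mulfK _)); rewrite normr_eq0 => /(_ d0).
  rewrite divff ?normr_eq0 // => Nk.
  have := row1 k; rewrite (bigD1 k) //= Nk expr1n => /(canRL (addKr _)).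
  rewrite addNr => /eqP; rewrite psumr_eq0 => [/allP/(_ j)|i _]; last exact: exprn_ge0.
  rewrite mem_index_enum eq_sym kj /= expf_eq0 normr_eq0 /= => /(_ isT)/eqP->.
  exact: mulr0.
have Nd : N *m diag_mx d = diag_mx a.
  have := congr1 (fun X => X ^t*) dN; rewrite /= trmxC_mul hN trmxC_real_diag //.
  by rewrite trmxC_real_diag // => k; rewrite mxE normr_real.
split; first by rewrite /comm_mx EUA EAU dN Nd.
move=> v; rewrite EUA Nd => Uv j.
(* The entry [Uv] is a sum of nonnegative terms [|d 0 k| * |P k v|^2], so each of them is zero. *)
have Pv k : d 0 k * P k v = 0.
  move: Uv; rewrite mxE => /eqP; rewrite psumr_eq0 => [/allP/(_ k)|i _].
    rewrite mem_index_enum mul_mx_diag !mxE => /(_ isT).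
    rewrite !mulf_eq0 conjC_eq0 normr_eq0 /= => H; apply/eqP; rewrite mulf_eq0.
    by case/orP: H => [/orP[]|] ->; rewrite ?orbT.
  by rewrite mul_mx_diag !mxE mulrAC mulr_ge0 // mulrC mul_conjC_ge0.
rewrite EA mxE big1 // => k _; rewrite mul_mx_diag !mxE.
have /(congr1 Num.conj) := Pv k; rewrite rmorphM rmorph0 /= (CrealP (dR k)).
by rewrite mulrC => ->; rewrite mul0r.
Qed.

(** Applied with [c] the component of [v] in the divided hypergraph and [t] another vertex of the
    divided edge. *)
Lemma trace_norm_pinch_lt n (A B : 'M[C]_n) (c : pred 'I_n) (v t : 'I_n) :
  A ^t* = A -> (forall i j, B i j = if c i == c j then A i j else 0) ->
  (forall i j, c i -> ~~ c j -> A i j != 0 -> i = v) ->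
  c v -> ~~ c t -> A v v = 0 -> A v t != 0 ->
  trace_norm B < trace_norm A.
Proof.
move=> hA BE Av cv ct Avv Avt.
have hB : B ^t* = B.
  by apply/matrixP=> i j; rewrite !mxE !BE eq_sym; case: ifP; rewrite ?conjC0 ?hermitian_conjE.
have [U [hU UU comU trU]] := hermitian_sign hB.
(* The block indicator [D] commutes with [B], hence with [U], and it separates the two blocks. *)
have Ublock i j : c i != c j -> U i j = 0.
  pose D : 'rV[C]_n := \row_k (c k)%:R.
  have /comU /matrixP/(_ i j) : comm_mx (diag_mx D) B.
    apply/matrixP=> k l; rewrite mul_diag_mx mul_mx_diag !mxE BE.
    by case: eqP => [->|_]; rewrite ?mulr0 ?mul0r // mulrC.
  rewrite mul_diag_mx mul_mx_diag !mxE.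
  by case: (c i) (c j) => [] [] // E _; move: E;
    rewrite ?(mul0r, mulr0) ?(mul1r, mulr1).
have -> : trace_norm B = \tr (U *m A).
  rewrite -trU /mxtrace; apply: eq_bigr => i _; rewrite !mxE; apply: eq_bigr => j _.
  by rewrite BE eq_sym; case: ifP => // /negbT /Ublock->; rewrite !mul0r.
have [//|[comA rowA]] := trace_mul_involution_lt hA hU UU.
have comX : comm_mx U (A - B) by apply: comm_mxB => //; apply/comm_mx_sym/comU.
have Xoff i j : c i != c j -> (A - B) i j = A i j.
  by move=> cij; rewrite !mxE BE (negPf cij) subr0.
have Xin i j : c i = c j -> (A - B) i j = 0.
  by move=> cij; rewrite !mxE BE cij eqxx subrr.
(* Compare the entries (i, t) of U (A - B) = (A - B) U. *)
have Uv i : i != v -> U i v = 0.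
  move=> iv; have [ci|nci] := boolP (c i); last first.
    by apply: Ublock; rewrite cv (negPf nci).
  (* On the left only [j = v] survives, leaving [U i v * A v t]; on the right row [i] of [A - B] is
     zero, since [i] is in the block and differs from [v]. *)
  have /matrixP/(_ i t) := comX; rewrite !mxE (bigD1 v) //= big1 => [|j jv].
    rewrite Xoff ?cv ?(negPf ct) // addr0 big1 => [/eqP|j _].
      by rewrite mulf_eq0 (negPf Avt) orbF => /eqP.
    have [cj|ncj] := boolP (c j); first by rewrite Xin ?ci ?cj ?mul0r.
    rewrite Xoff ?ci ?(negPf ncj) //.
    have [->|/(Av _ _ ci ncj) Ei] := eqVneq (A i j) 0; first by rewrite mul0r.
    by rewrite Ei eqxx in iv.
  have [cj|ncj] := boolP (c j); last by rewrite Ublock ?ci ?(negPf ncj) // mul0r.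
  rewrite Xoff ?cj ?(negPf ct) //.
  have [->|/(Av _ _ cj ct) Ej] := eqVneq (A j t) 0; first by rewrite mulr0.
  by rewrite Ej eqxx in jv.
(* Column [v] of [U] is zero off the diagonal, so [(A U) v v] reduces to [A v v * U v v = 0]. *)
case/eqP: Avt; apply: rowA; rewrite comA mxE (bigD1 v) //= Avv mul0r big1 ?addr0 //.
by move=> j /Uv->; rewrite mulr0.
Qed.

End TraceNorm.

(** * Walks as paths of an adjacency relation *)

Section Connectivity.
Variables (V : finType) (E : multihypergraph V).

Definition adjacent : rel V :=
  [rel x y | [exists f : {set V}, [&& f \in E, x \in f, y \in f & x != y]]].

Lemma adjacent_sym : symmetric adjacent.
Proof.
move=> x y; apply: eq_existsb => f; rewrite eq_sym.
by case: (x \in f); case: (y \in f).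
Qed.

Lemma connected_adjacentP : connected E <-> forall x y, connect adjacent x y.
Proof.
split=> [conE x y | conE x y].
  have [w [walk_w <-]] := conE x y.
  elim: w x walk_w => [|[f z] w IHw] x /=; first by rewrite connect0.
  case/and5P=> fE xf zf xz /IHw; apply: connect_trans; apply: connect1.
  by apply/existsP; exists f; rewrite fE xf zf.
have /connectP[p p_path ->] := conE x y.
elim: p x p_path => [|z p IHp] x /=; first by exists [::].
case/andP=> /existsP[f /and4P[fE xf zf xz]] /IHp[w [walk_w lw]].
by exists ((f, z) :: w); rewrite /= fE xf zf xz.
Qed.

Lemma codegree_gt0 x y :
  (0 < codegree E x y)%N = [exists f : {set V}, [&& f \in E, x \in f & y \in f]].
Proof.
rewrite lt0n sum_nat_eq0 negb_forall; apply: eq_existsb => f.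
by rewrite negb_imply mset_neq0 andbC andbA.
Qed.

Lemma adjacentE x y : adjacent x y = (x != y) && (0 < codegree E x y)%N.
Proof.
rewrite codegree_gt0; apply/existsP/andP => [[f /and4P[fE xf yf xy]]|].
  by split=> //; apply/existsP; exists f; rewrite fE xf.
by case=> xy /existsP[f /and3P[fE xf yf]]; exists f; rewrite fE xf yf.
Qed.

End Connectivity.

(** * Codegrees and components after dividing one edge *)

Section Division.
Variables (V : finType) (H : hypergraph V) (e : {set V}).
Hypothesis He : e \in edges H.

Lemma mem_multi_of f : (f \in multi_of H) = (f \in edges H).
Proof. by rewrite in_mset mset_seqE -has_count has_pred1 mem_enum. Qed.

(** The removed copy of [e] stands on the left to avoid truncated subtraction; the multiset
    difference is exact because [e] is an edge. *)
Lemma edge_division1E (f g : {set V} -> {set V}) x :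
  (edge_division H [set e] f g x + (x == e)
    = multi_of H x + (x == f e) + (x == g e))%N.
Proof.
have He' : (x == e <= multi_of H x)%N.
  by case: eqP => // ->; rewrite mset_gt0 mem_multi_of.
rewrite /edge_division enum_set1 /= !msetE2 !mset_seqE /= !addn0 !(eq_sym _ x).
rewrite subnK // -addnA; apply: leq_trans (leq_addr _ _).
by rewrite mset_seqE in He'.
Qed.

Lemma sum_delta (P : pred {set V}) a : (\sum_(x | P x) (x == a) = P a)%N.
Proof.
rewrite big_mkcond (bigD1 a) //= eqxx big1 => [|x /negPf->]; last by case: ifP.
by rewrite addn0; case: (P a).
Qed.

Lemma codegree_division1 (f g : {set V} -> {set V}) i j :
  (codegree (edge_division H [set e] f g) i j + ((i \in e) && (j \in e))
   = codegree (multi_of H) i j + ((i \in f e) && (j \in f e))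
     + ((i \in g e) && (j \in g e)))%N.
Proof.
rewrite /codegree -!(sum_delta (fun x => (i \in x) && (j \in x))) -!big_split /=.
by apply: eq_bigr => x _; rewrite edge_division1E.
Qed.

Variable v : V.
Hypothesis Hv : v \in e.
Let E' := edge_division H [set e] (fun x => x :\ v) (fun _ => [set v]).

(** Passing to [e :\ v] loses exactly the pairs of [e] through [v], and [[set v]] contains no pair
    to compensate. *)
Lemma codegree_division_vertex i j : i != j ->
  (codegree E' i j + [&& i \in e, j \in e & (i == v) || (j == v)]
   = codegree (multi_of H) i j)%N.
Proof.
move=> ij; have := codegree_division1 (fun x => x :\ v) (fun _ => [set v]) i j.
rewrite -/E' !inE.
have -> : (i == v) && (j == v) = false.
  by apply: contraNF ij => /andP[/eqP-> /eqP->].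
rewrite addn0; case: (i \in e) (j \in e) => [] [] /=; rewrite ?andbF ?addn0 //.
by case: (i == v) (j == v) => [] [] //=; rewrite ?addn0 // => /addIn.
Qed.

(** If [v] still reached [t], the surviving edge [e :\ v] would link it to all of [e]; every
    adjacency lost in the division could be rerouted, and [E'] would be connected. *)
Lemma division_disconnected_notin t : connected (multi_of H) -> ~ connected E' ->
  t \in e :\ v -> ~~ connect (adjacent E') v t.
Proof.
move=> /connected_adjacentP conH dE' te; apply/negP => vt; apply: dE'.
have symE' : connect_sym (adjacent E') by apply: sym_connect_sym; exact: adjacent_sym.
have evE' : e :\ v \in E'.
  rewrite -mset_gt0; have := edge_division1E (fun x => x :\ v) (fun _ => [set v]) (e :\ v).
  have -> : (e :\ v == e) = false by apply/eqP => /setP/(_ v); rewrite !inE eqxx Hv.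
  by rewrite -/E' addn0 eqxx => ->; rewrite addn1.
have conev x : x \in e -> connect (adjacent E') v x.
  move=> xe; have [->|xv] := eqVneq x v; first exact: connect0.
  have [->//|tx] := eqVneq x t; apply: connect_trans vt _; apply: connect1.
  by apply/existsP; exists (e :\ v); rewrite evE' te !inE xv xe eq_sym.
apply/connected_adjacentP => x y; apply: connect_sub (conH x y) => {x y} x y.
rewrite adjacentE => /andP[xy]; rewrite -codegree_division_vertex // addn_gt0.
case/orP=> [xyE'|]; first by apply: connect1; rewrite adjacentE xy.
rewrite lt0b => /and3P[xe ye _].
by apply: connect_trans (conev y ye); rewrite symE' conev.
Qed.

End Division.

(** * From the divided hypergraph to block matrices *)

Theorem theorem18 (C : numClosedFieldType) (V : finType) (H : hypergraph V)
    (e : {set V}) (v : V) (He : e \in edges H) (Hv : v \in e)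
    (Hconn : connected (multi_of H))
    (Hcut : weak_cut H [set e] (fun x => x :\ v) (fun _ => [set v])) :
  energy C (edge_division H [set e] (fun x => x :\ v) (fun _ => [set v]))
    < energy C (multi_of H).
Proof.
have [_ _ Hdis _] := Hcut.
have [t te] : exists t, t \in e :\ v.
  apply/set0Pn; rewrite -card_gt0; have := edges_card He.
  by rewrite (cardsD1 v) Hv.
have sep := division_disconnected_notin He Hv Hconn Hdis.
have codeg := codegree_division_vertex He v.
move: sep codeg; set E' := edge_division _ _ _ _ => sep codeg.
have symE' : connect_sym (adjacent E') by apply: sym_connect_sym; exact: adjacent_sym.
have cross i j : connect (adjacent E') v i -> ~~ connect (adjacent E') v j ->
    codegree E' i j = 0%N.
  move=> ci ncj; apply/eqP; rewrite -leqn0 leqNgt; apply: contra ncj => cij.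
  have [<-//|ij] := eqVneq i j.
  by apply: connect_trans ci (connect1 _); rewrite adjacentE ij.
have end_v x : x \in e -> connect (adjacent E') v x -> x = v.
  move=> xe; apply: contraTeq => xv; apply: sep; by rewrite !inE xv.
have codegC F (x y : V) : codegree F x y = codegree F y x.
  by apply: eq_bigl => f; rewrite andbC.
have rankv k : (k == enum_rank v) = (enum_val k == v).
  by rewrite -(inj_eq enum_rank_inj) enum_valK.
apply: (@trace_norm_pinch_lt _ _ _ _ (fun k => connect (adjacent E') v (enum_val k))
          (enum_rank v) (enum_rank t)).
- by apply/matrixP=> i j; rewrite !mxE eq_sym codegC; case: ifP; rewrite ?conjC0 ?conjC_nat.
- move=> i j; rewrite !mxE; have [->|ij] := eqVneq i j; first by rewrite eqxx.
  have vij : enum_val i != enum_val j by rewrite (inj_eq enum_val_inj).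
  rewrite -codeg //.
  (* Inside a block no pair is lost: a lost pair contains [v] and a second vertex of [e], which by
     [end_v] is outside the component of [v]. *)
  case ci: (connect _ v (enum_val i)); case cj: (connect _ v (enum_val j)) => /=.
  + case: and3P => [[ie je _]|_]; last by rewrite addn0.
    by rewrite (end_v _ ie ci) (end_v _ je cj) eqxx in vij.
  + by rewrite cross ?cj.
  + by rewrite codegC cross ?ci.
  + case: and3P => [[_ _]|_]; last by rewrite addn0.
    by case/orP=> /eqP Ev; move: ci cj; rewrite Ev connect0.
(* Across the blocks [E'] contributes nothing, so a nonzero entry is a lost pair, and its end in the
   component of [v] is [v]. *)
- move=> i j ci ncj; rewrite mxE; case: ifP => [|/negbT ij]; first by rewrite eqxx.
  have vij : enum_val i != enum_val j by rewrite (inj_eq enum_val_inj).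
  rewrite -codeg // cross // pnatr_eq0 => /=; rewrite eqb0 negbK => /and3P[ie _ _].
  by apply/eqP; rewrite rankv (end_v _ ie ci).
- by rewrite enum_rankK connect0.
- by rewrite enum_rankK sep.
- by rewrite mxE eqxx.
(* The pair of [v] and [t] is itself lost, so its codegree in [H] is a successor. *)
- move: (te); rewrite !inE => /andP[tv te'].
  rewrite mxE (inj_eq enum_rank_inj) (eq_sym v) (negPf tv) !enum_rankK pnatr_eq0.
  by rewrite -codeg 1?eq_sym // Hv te' eqxx addn1.
Qed.
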